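(* Let $\mathcal{M}$ be a matroid with set of bases $\mathcal{B}$, $b:=|\mathcal{B}|$. Consider the equivalence relation $\sim$ on unordered pairs of distinct bases given by $\{B_1,B_2\}\sim\{B_3,B_4\}$ iff $B_1\cup B_2=B_3\cup B_4$ as multisets, and let $\{\{B_1,B_2\},\ldots,\{B_{2s-1},B_{2s}\}\}$ be a set of representatives of its equivalence classes (so $s$ is the number of classes). Set $r_i:=\Delta_{\{B_{2i-1},B_{2i}\}}$ for $i\in\{1,\ldots,s\}$. Then (1) $\mu(I_{\mathcal{M}})\geq (b^2-b-2s)/2$, and (2) $\nu(I_{\mathcal{M}})\geq\prod_{i=1}^s r_i^{\,r_i-2}$. Moreover, in both cases equality holds whenever $I_{\mathcal{M}}$ is generated by quadratics.
   Context: Let $\mathcal{M}$ be a matroid on $E=\{1,\ldots,n\}$, $k$ a field, $R=k[y_B\mid B\in\mathcal{B}]$ and $\varphi:R\to k[x_1,\ldots,x_n]$ the $k$-algebra map $y_B\mapsto\prod_{i\in B}x_i$; the toric ideal is $I_{\mathcal{M}}=\ker\varphi$, a homogeneous binomial ideal. $\mu(I_{\mathcal{M}})$ is the minimal number of generators of $I_{\mathcal{M}}$, and $\nu(I_{\mathcal{M}})$ is the number of minimal generating sets of $I_{\mathcal{M}}$ consisting of binomials, where binomials differing only by sign are identified. $\Delta_{\{B,B'\}}$ is the number of unordered pairs $\{D_1,D_2\}$ of bases with $D_1\cup D_2=B\cup B'$ as multisets, i.e. the size of the $\sim$-class of $\{B,B'\}$. ''Generated by quadratics'' means generated by homogeneous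 polynomials of degree $2$. *)

(* Defs.v *)
From HB Require Import structures.
From mathcomp Require Import all_boot all_order all_algebra.
From mathcomp Require Import finmap.
From mathcomp Require Import mpoly.

Set Implicit Arguments.
Unset Strict Implicit.
Unset Printing Implicit Defensive.

Import GRing.Theory.
Local Open Scope ring_scope.
Local Open Scope fset_scope.

Definition is_matroid_bases (n : nat) (Bs : {set {set 'I_n}}) : Prop :=
  Bs != set0 /\
  forall B1 B2, B1 \in Bs -> B2 \in Bs ->
    forall x, x \in B1 :\: B2 ->
      exists2 y, y \in B2 :\: B1 & (B1 :\ x) :|: [set y] \in Bs.

(* Variables y_B of R = k[y_B | B in Bs] are indexed by 'I_#|Bs|,
   the i-th variable corresponding to the basis enum_val i. *)
Definition basis_of (n : nat) (Bs : {set {set 'I_n}}) (i : 'I_#|Bs|)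
  : {set 'I_n} := @enum_val _ (mem Bs) i.

Definition toric_map (k : fieldType) (n : nat) (Bs : {set {set 'I_n}})
  (p : {mpoly k[#|Bs|]}) : {mpoly k[n]} :=
  p \mPo [tuple (\prod_(j in @basis_of n Bs i) 'X_j : {mpoly k[n]}) | i < #|Bs|].

Definition toric_ideal (k : fieldType) (n : nat) (Bs : {set {set 'I_n}})
  (p : {mpoly k[#|Bs|]}) : Prop := toric_map p = 0.

Definition in_ideal_gen (R : comRingType) (S : seq R) (p : R) : Prop :=
  exists c : seq R, p = \sum_(i < size S) c`_i * S`_i.

Definition generates (R : comRingType) (S : seq R) (I : R -> Prop) : Prop :=
  (forall q, q \in S -> I q) /\ (forall p, I p -> in_ideal_gen S p).

Definition generated_by_quadratics (k : fieldType) (m : nat)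
  (I : {mpoly k[m]} -> Prop) : Prop :=
  exists S : seq {mpoly k[m]}, generates S I /\ all (fun q => q \is 2.-homog) S.

(* A binomial x^u - x^v (u <> v), with x^u - x^v identified with x^v - x^u,
   is encoded by the 2-element set {u, v} of exponent vectors. *)
Definition binom_of (k : fieldType) (m : nat) (P : {fset 'X_{1..m}})
  : {mpoly k[m]} :=
  match enum_fset P with
  | u :: v :: _ => 'X_[u] - 'X_[v]
  | _ => 0
  end.

Definition binom_polys (k : fieldType) (m : nat) (S : {fset {fset 'X_{1..m}}})
  : seq {mpoly k[m]} := [seq binom_of k P | P <- enum_fset S].

Definition minimal_binomial_gen_set (k : fieldType) (m : nat)
  (I : {mpoly k[m]} -> Prop) (S : {fset {fset 'X_{1..m}}}) : Prop :=
  (forall P, P \in S -> #|` P| = 2%N) /\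
  generates (binom_polys k S) I /\
  (forall S' : {fset {fset 'X_{1..m}}}, S' `<` S -> ~ generates (binom_polys k S') I).

Definition basis_pairs (n : nat) (Bs : {set {set 'I_n}}) : {set {set {set 'I_n}}} :=
  [set X : {set {set 'I_n}} | (X \subset Bs) && (#|X| == 2%N)].

Definition msunion (n : nat) (X : {set {set 'I_n}}) : {ffun 'I_n -> nat} :=
  [ffun e => (\sum_(B in X) (e \in B))%N].

Definition pair_class (n : nat) (Bs : {set {set 'I_n}}) (X : {set {set 'I_n}})
  : {set {set {set 'I_n}}} :=
  [set Y in basis_pairs Bs | msunion Y == msunion X].

Definition Delta (n : nat) (Bs : {set {set 'I_n}}) (X : {set {set 'I_n}}) : nat :=
  #|pair_class Bs X|.

Definition pair_classes (n : nat) (Bs : {set {set 'I_n}})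
  : {set {set {set {set 'I_n}}}} :=
  [set pair_class Bs X | X in basis_pairs Bs].

(* Main.v *)
Require Import Defs.
From Stdlib Require Import Classical.
From HB Require Import structures.
From mathcomp Require Import all_boot all_order all_algebra perm.
From mathcomp Require Import finmap.
From mathcomp Require Import mpoly.

(* A binomial x^u - x^v lies in I iff u and v have the same image wt u = wt v
   under the map of exponents induced by phi. All bases having the same positive
   cardinality, I has no nonzero element of degree less than 2, and a quadratic
   monomial is either alone in its fibre of wt or the monomial y_B y_B' of a pair
   {B, B'}; the fibres of the latter are the classes of ~.

   Hence the coefficients at the quadratic monomials of the pairs of a multiple c q
   of q in I are those of c(0) q. For (1), the binomials joining each pair to the
   representative of its class are independent in these coordinates and must be
   spanned by the generators. For (2), the edges {y_B y_B', y_D y_D'} of a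
   binomial generating set connect every class: the sum of the coefficients over a
   union of connected components vanishes on the ideal. Conversely every choice of
   one spanning tree per class extends to a minimal generating set by
   non-quadratic binomials, and if I is generated by quadratics the minimal
   binomial generating sets are exactly these choices.

   Cayley's formula counts them. For forests with prescribed roots, r of them in a
   class of size a, making a further vertex v of that class a root multiplies the
   number of forests by (r + 1) / (r a): a forest is recovered by grafting v on a
   vertex outside its own tree, and by symmetry this tree has on average
   a / (r + 1) vertices. *)

Set Implicit Arguments.
Unset Strict Implicit.
Unset Printing Implicit Defensive.

(** * Counting rooted forests *)

Section Forests.
Variables (V K : finType) (lab : V -> K).
Implicit Types (f g : {ffun V -> V}) (R : {set V}) (x y v w : V).

(* A spanning forest whose trees lie inside the label classes and are rooted at
   [R] is encoded by its parent function, the roots being the fixed points. *)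
Definition forests R : {set {ffun V -> V}} :=
  [set f : {ffun V -> V} | [&& [forall x in R, f x == x],
     [forall x, lab (f x) == lab x] &
     [forall x, [exists r in R, fconnect f x r]]]].

Lemma forestsP R f :
  reflect [/\ {in R, forall x, f x = x}, forall x, lab (f x) = lab x &
              forall x, exists2 r, r \in R & fconnect f x r]
          (f \in forests R).
Proof.
rewrite inE; apply: (iffP and3P) => -[h1 h2 h3]; split.
- by move=> x xR; apply/eqP; move/forall_inP: h1; apply.
- by move=> x; apply/eqP; move/forallP: h2; apply.
- by move=> x; move/forallP/(_ x)/exists_inP: h3.
- by apply/forall_inP => x xR; rewrite h1.
- by apply/forallP => x; rewrite h2.
- by apply/forallP => x; apply/exists_inP.
Qed.

(** Path induction, on the number of iterations of [f] that lead to [y]. *)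
Lemma fconnect_ind f (P : V -> Prop) y :
  P y -> (forall x, P (f x) -> P x) -> forall x, fconnect f x y -> P x.
Proof.
move=> Py Pf x /iter_findex; move: (findex f x y) => i.
by elim: i x => [x /= -> //|i IHi x]; rewrite iterSr => /IHi/Pf.
Qed.

Lemma fconnect_step f x y : fconnect f (f x) y -> fconnect f x y.
Proof. exact: connect_trans (fconnect1 f x). Qed.

Lemma fconnect_fix f x y : f x = x -> fconnect f x y -> y = x.
Proof.
by move=> fx /iter_findex <-; elim: (findex f x y) => //= i ->.
Qed.

Lemma fconnect_lab f x y :
  (forall x, lab (f x) = lab x) -> fconnect f x y -> lab y = lab x.
Proof.
by move=> h; move: x; apply: fconnect_ind => // x; rewrite h.
Qed.

Lemma forests_root_uniq R f x r s : f \in forests R -> r \in R -> s \in R ->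
  fconnect f x r -> fconnect f x s -> r = s.
Proof.
case/forestsP => fR _ _ rR sR xr.
move: x xr; apply: fconnect_ind.
  by move/(fconnect_fix (fR _ rR)).
move=> x IH xs; apply: IH.
have [xR|xs'] := boolP (x \in R); first by rewrite fR.
have := iter_findex xs; case E: (findex f x s) => [|i].
  by move=> /= e; rewrite e sR in xs'.
by rewrite iterSr => <-; exact: fconnect_iter.
Qed.

(** On a cycle through [x], every point reached from [x] leads back to [x]. The root reached from
    [x] is fixed, so it would be [x] itself. *)
Lemma forests_acyclic R f x : f \in forests R -> x \notin R ->
  ~~ fconnect f (f x) x.
Proof.
move=> fF; case/forestsP: (fF) => fR _ fc xR; apply/negP => cyc.
have [r rR xr] := fc x.
suff : x = r by move=> e; rewrite e rR in xR.
pose P y := fconnect f y x.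
have Px : P r.
  have := iter_findex xr => <-.
  elim: (findex f x r) => [|i IHi]; first exact: connect0.
  rewrite iterS /P.
  have := iter_findex IHi; case E: (findex _ _ _) => [|j].
    by move=> /= ->.
  by rewrite iterSr => {2}<-; exact: fconnect_iter.
by apply/(fconnect_fix (fR _ rR)).
Qed.

Definition upd f v w : {ffun V -> V} := [ffun x => if x == v then w else f x].

Lemma upd_same f v w : upd f v w v = w.
Proof. by rewrite ffunE eqxx. Qed.

Lemma upd_diff f v w x : x != v -> upd f v w x = f x.
Proof. by move=> /negbTE xv; rewrite ffunE xv. Qed.

(** Vertices whose path passed through [v] now stop there. The old parent of [v] cannot lead to [v],
    since [f] has no cycle. *)
Lemma forests_cut R f v : f \in forests R -> v \notin R ->
  upd f v v \in forests (v |: R) /\ ~~ fconnect (upd f v v) (f v) v.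
Proof.
move=> fF vR; case/forestsP: (fF) => fR fl fc; split.
  apply/forestsP; split.
  - move=> x; rewrite !inE ffunE; case: eqP => [-> //|_ /=]; exact: fR.
  - by move=> x; rewrite ffunE; case: eqP => [-> //|].
  move=> x; have [r rR] := fc x.
  move: x; apply: fconnect_ind; first by exists r; rewrite ?connect0 // !inE rR orbT.
  move=> x [s sR xs]; case: (eqVneq x v) => [->|xv].
    by exists v; rewrite ?connect0 // !inE eqxx.
  by exists s => //; apply: fconnect_step; rewrite upd_diff.
apply: contra (forests_acyclic fF vR).
move: (f v); apply: fconnect_ind; first exact: connect0.
move=> x; case: (eqVneq x v) => [-> _|xv]; first exact: connect0.
by rewrite upd_diff //; exact: fconnect_step.
Qed.

(** The inverse of cutting: the path from [w] avoids [v], so it still ends in [R], and the whole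
    tree of [v] follows it. *)
Lemma forests_graft R g v w : g \in forests (v |: R) -> v \notin R ->
  lab w = lab v -> ~~ fconnect g w v -> upd g v w \in forests R.
Proof.
move=> gF vR lw wv; case/forestsP: (gF) => gR gl gc.
have away x : ~~ fconnect g x v -> exists2 r, r \in R & fconnect (upd g v w) x r.
  move=> xv; have [r rR xr] := gc x; exists r.
    case/setU1P: rR => // rv; by rewrite -rv xr in xv.
  move: x xr xv; apply: fconnect_ind; first by rewrite connect0.
  move=> x IH xv; apply: fconnect_step; rewrite upd_diff ?IH //.
    by apply: contra xv; exact: fconnect_step.
  by apply: contraNneq xv => ->; exact: connect0.
apply/forestsP; split.
- move=> x xR; rewrite upd_diff ?gR ?inE ?xR ?orbT //.
  by apply: contraNneq vR => <-.
- by move=> x; rewrite ffunE; case: eqP => [-> //|].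
move=> x; have [xv|] := boolP (fconnect g x v); last exact: away.
move: x xv; apply: fconnect_ind.
  have [r rR wr] := away w wv; exists r => //.
  by apply: fconnect_step; rewrite upd_same.
move=> x [r rR xr]; case: (eqVneq x v) => [->|xv].
  have [s sR ws] := away w wv; exists s => //.
  by apply: fconnect_step; rewrite upd_same.
by exists r => //; apply: fconnect_step; rewrite upd_diff.
Qed.

Definition label_class (c : K) : {set V} := [set x | lab x == c].

(** Cutting at [v] identifies [forests R] with the pairs of a forest [g] and a vertex [w] of the
    class of [v] outside the tree of [v]; the sum counts the vertices inside that tree. *)
Lemma card_forests_graft R v : v \notin R ->
  #|forests R| + \sum_(g in forests (v |: R)) #|[set w | fconnect g w v]| =
  #|label_class (lab v)| * #|forests (v |: R)|.
Proof.
move=> vR.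
pose D := [set p : {ffun V -> V} * V | (p.1 \in forests (v |: R)) &&
   ((lab p.2 == lab v) && ~~ fconnect p.1 p.2 v)].
have cardD : #|forests R| = #|D|.
  have -> : D = [set (upd f v v, f v) | f in forests R].
    apply/setP => -[g w]; apply/idP/imsetP => [|[f fF [-> ->]]].
      rewrite inE /= => /and3P[gF /eqP lw wv].
      exists (upd g v w); first exact: forests_graft.
      rewrite upd_same; congr pair; apply/ffunP => x; rewrite !ffunE.
      case: eqP => // ->; case/forestsP: gF => gR _ _.
      by rewrite gR // !inE eqxx.
    have [h1 h2] := forests_cut fF vR; rewrite inE /= h1 h2 andbT /=.
    by case/forestsP: fF => _ fl _; rewrite fl.
  rewrite card_in_imset // => f g fF gF [e1 e2]; apply/ffunP => x.
  case: (eqVneq x v) => [-> //|xv].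
  by rewrite -(upd_diff f v xv) e1 upd_diff.
rewrite {}cardD -sum1_card (eq_bigl (fun p => (p.1 \in forests (v |: R)) &&
   ((lab p.2 == lab v) && ~~ fconnect p.1 p.2 v))); last by move=> p; rewrite inE.
rewrite -(pair_big_dep (fun g => g \in forests (v |: R))
   (fun g w => (lab w == lab v) && ~~ fconnect g w v) (fun _ _ => 1)) /=.
rewrite -big_split /= mulnC -sum_nat_const; apply: eq_bigr => g gF.
rewrite sum1dep_card -(cardsID [set w | fconnect g w v] (label_class _)) addnC.
congr (_ + _); apply: eq_card => w; rewrite !inE.
  case: (boolP (fconnect g w v)); rewrite ?andbF // andbT => wv.
  by case/forestsP: gF => _ gl _; rewrite (fconnect_lab gl wv) eqxx.
by rewrite andbC.
Qed.

(** Conjugation by the transposition of [v] and [r] permutes the forests and exchanges the trees of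
    these two roots. *)
Lemma card_subtree_sym R v r : v \in R -> r \in R -> lab r = lab v ->
  \sum_(g in forests R) #|[set w | fconnect g w v]| =
  \sum_(g in forests R) #|[set w | fconnect g w r]|.
Proof.
move=> vR rR lr; pose t := tperm v r.
have tR x : (t x \in R) = (x \in R) by rewrite /t; case: tpermP => [->|->|//]; rewrite vR rR.
have tl x : lab (t x) = lab x by rewrite /t; case: tpermP => [->|->|//].
have tK : involutive t by exact: tpermK.
pose h g : {ffun V -> V} := [ffun x => t (g (t x))].
have hK : involutive h by move=> g; apply/ffunP => x; rewrite !ffunE !tK.
have hc g x y : fconnect g x y -> fconnect (h g) (t x) (t y).
  move: x; apply: fconnect_ind; first exact: connect0.
  by move=> z; rewrite -{1}(tK z) => hz; apply: fconnect_step; rewrite ffunE !tK in hz *.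
have hF g : g \in forests R -> h g \in forests R.
  case/forestsP => gR gl gc; apply/forestsP; split.
  - by move=> x xR; rewrite ffunE gR ?tK ?tR.
  - by move=> x; rewrite ffunE tl gl tl.
  move=> x; have [s sR xs] := gc (t x); exists (t s); first by rewrite tR.
  by rewrite -[x]tK; exact: hc.
rewrite (reindex_inj (can_inj hK)) /=.
apply: eq_big => [g|g _].
  by apply/idP/idP => [/hF|]; [rewrite hK | exact: hF].
rewrite -(card_imset _ (can_inj tK)); apply: eq_card => w.
rewrite inE; apply/imsetP/idP => [[x]|wr].
  rewrite inE => /hc; rewrite hK => + -> => hx.
  by rewrite /t tpermL in hx.
exists (t w); last by rewrite tK.
by rewrite inE -[v]tK /t tpermL; exact: hc.
Qed.

(* By [card_subtree_sym], the average size of the tree at [v] over the forests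
   rooted at [v |: R] is the size of the class divided by its number of roots. *)
Lemma card_forests_step R v : v \notin R ->
  #|R :&: label_class (lab v)|.+1 * #|forests R| =
  #|R :&: label_class (lab v)| * #|label_class (lab v)| * #|forests (v |: R)|.
Proof.
move=> vR; set a := #|label_class _|; set r := #|_ :&: _|.
set N := #|forests (v |: R)|.
set T := \sum_(g in forests (v |: R)) #|[set w | fconnect g w v]|.
have graft : #|forests R| + T = a * N by exact: card_forests_graft.
suff avg : r.+1 * T = a * N.
  apply/eqP; rewrite -(eqn_add2r (r.+1 * T)) -mulnDr graft avg; apply/eqP.
  by rewrite mulSn addnC mulnA.
pose Rv := (v |: R) :&: label_class (lab v).
have <- : #|Rv| = r.+1.
  have -> : Rv = v |: (R :&: label_class (lab v)).
    by rewrite /Rv setIUl; congr (_ :|: _); apply/setIidPl; rewrite sub1set inE.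
  by rewrite cardsU1 inE (negbTE vR).
(* Summing over all roots of the class counts every vertex of the class once in each forest, at its
   unique root. *)
rewrite -sum_nat_const (eq_bigr (fun r => \sum_(g in forests (v |: R)) #|[set w | fconnect g w r]|)).
  rewrite exchange_big /= mulnC /N -sum_nat_const; apply: eq_bigr => g gF.
  rewrite (eq_bigr (fun r => \sum_(w in label_class (lab v)) (fconnect g w r : nat))).
    rewrite exchange_big /= /a -sum1_card; apply: eq_bigr => w; rewrite inE => /eqP lw.
    case/forestsP: (gF) => gR gl /(_ w)[s sR ws].
    have sRv : s \in Rv by rewrite inE sR inE (fconnect_lab gl ws) lw eqxx.
    rewrite (bigD1 s) //= ws big1 // => s' /andP[]; rewrite inE => /andP[s'R _] ss'.
    case ws': (fconnect g w s') => //.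
    by rewrite (forests_root_uniq gF s'R sR ws' ws) eqxx in ss'.
  move=> s; rewrite !inE => /andP[_ /eqP ls].
  rewrite -sum1_card big_mkcond [RHS]big_mkcond; apply: eq_bigr => w _.
  rewrite !inE; case ws: (fconnect g w s); last by rewrite if_same.
  by case/forestsP: gF => _ gl _; rewrite -ls (fconnect_lab gl ws) eqxx.
move=> s; rewrite inE => /andP[sR]; rewrite inE => /eqP ls.
by apply: card_subtree_sym; rewrite // !inE eqxx.
Qed.

(* The powers on the left avoid the exponent [a - r - 1], negative when [r = a],
   in the count [r * a ^ (a - r - 1)] of the forests of one class. *)
Lemma card_forests R :
  #|forests R| * \prod_(c in lab @: V) #|label_class c| ^ #|R :&: label_class c| =
  \prod_(c in lab @: V) (#|R :&: label_class c| * #|label_class c| ^ #|label_class c|.-1).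
Proof.
move: {2}#|~: R| (erefl #|~: R|) => m; elim: m R => [|m IHm] R.
  move/eqP; rewrite cards_eq0 -setCT (inj_eq (inv_inj (@setCK _))) => /eqP ->.
  have -> : forests setT = [set [ffun x => x]].
    apply/setP => f; rewrite in_set1; apply/forestsP/eqP => [[fR _ _]|->].
      by apply/ffunP => x; rewrite ffunE fR.
    split=> [x _|x|x]; rewrite ?ffunE //.
    by exists x; rewrite ?connect0.
  rewrite cards1 mul1n; apply: eq_bigr => c /imsetP[x _ ->]; rewrite setTI -expnS prednK //.
  by apply/card_gt0P; exists x; rewrite inE.
move=> cR; have [v] : exists v, v \in ~: R by apply/card_gt0P; rewrite cR.
rewrite inE => vR.
have cR' : #|~: (v |: R)| = m.
  apply/eqP; rewrite -eqSS -cR (cardsD1 v (~: R)) inE vR add1n eqSS.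
  by apply/eqP/eq_card => x; rewrite !inE negb_or.
have {cR'} := IHm _ cR'; set c := lab v.
have cin : c \in lab @: V by rewrite imset_f.
have oth d : d != c -> (v |: R) :&: label_class d = R :&: label_class d.
  move=> dc; apply/setP => x; rewrite !inE.
  by case: (eqVneq x v) => // -> /=; rewrite eq_sym (negbTE dc) andbF.
have own : #|(v |: R) :&: label_class c| = #|R :&: label_class c|.+1.
  have -> : (v |: R) :&: label_class c = v |: (R :&: label_class c).
    by rewrite setIUl; congr (_ :|: _); apply/setIidPl; rewrite sub1set inE.
  by rewrite cardsU1 inE (negbTE vR).
rewrite !(bigD1 c cin) /= own.
under eq_bigr => d /andP[_ dc] do rewrite oth //.
under [in RHS]eq_bigr => d /andP[_ dc] do rewrite oth //.
have := card_forests_step vR; rewrite -/c.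
move: #|forests R| #|forests (v |: R)| => N N'.
set P := \prod_(_ | _) _; set Q := \prod_(_ | _) _.
move: #|R :&: _| #|label_class c| => r a step IH.
apply/eqP; rewrite -(eqn_pmul2l (ltn0Sn r)) mulnA step; apply/eqP.
rewrite expnS in IH; transitivity (r * (N' * (a * a ^ r * P))).
  by rewrite -!mulnA; congr (_ * _); rewrite mulnCA.
by rewrite IH -!mulnA mulnCA.
Qed.

Lemma card_rooted_trees R :
  (forall c, c \in lab @: V -> #|R :&: label_class c| = 1) ->
  #|forests R| = \prod_(c in lab @: V) #|label_class c| ^ (#|label_class c| - 2).
Proof.
move=> R1; have := card_forests R.
under eq_bigr => c cV do rewrite R1 // expn1.
under [in RHS]eq_bigr => c cV do rewrite R1 // mul1n.
have a0 c : c \in lab @: V -> 0 < #|label_class c|.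
  by case/imsetP => x _ ->; apply/card_gt0P; exists x; rewrite inE.
have -> : \prod_(c in lab @: V) #|label_class c| ^ #|label_class c|.-1 =
  (\prod_(c in lab @: V) #|label_class c| ^ (#|label_class c| - 2)) *
  \prod_(c in lab @: V) #|label_class c|.
  rewrite -big_split /=; apply: eq_bigr => c /a0.
  (* A class of size 1 is treated apart: its exponent is truncated to 0, and both sides are 1. *)
  by case: #|_| => [//|[//|a]] _; rewrite -expnSr !subSS subn0.
move/eqP; rewrite eqn_pmul2r => [/eqP //|].
by apply: prodn_cond_gt0 => c; exact: a0.
Qed.

End Forests.

(** * Dickson's lemma *)

(** Induction on [N]. Finitely many tails lie below all the others. If [M] bounds the heads chosen
    for them, every sequence with head at least [M] is settled, and each of the finitely many heads
    below [M] leaves a slice of dimension [N]. *)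
Lemma dickson (N : nat) (P : seq nat -> Prop) :
  exists L : seq (seq nat),
    (forall t, t \in L -> size t = N /\ P t) /\
    (forall s, size s = N -> P s -> exists2 t, t \in L & forall i, nth 0 t i <= nth 0 s i).
Proof.
elim: N P => [|N IHN] P.
  have [P0|nP0] := classic (P [::]).
    exists [:: [::]]; split=> [t|s /size0nil ->]; first by rewrite inE => /eqP ->.
    by exists [::].
  by exists [::]; split=> // s /size0nil ->.
have [L' [L'P L'min]] := IHN (fun t => exists a, P (a :: t)).
have [M [LM [LMP LMmin]]] : exists M (LM : seq (seq nat)),
    (forall t, t \in LM -> size t = N.+1 /\ P t) /\
    (forall a s, M <= a -> size s = N -> P (a :: s) ->
      exists2 t, t \in LM & forall i, nth 0 t i <= nth 0 (a :: s) i).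
  have [M [LM [LMP LMmin]]] : exists M (LM : seq (seq nat)),
    (forall t, t \in LM -> size t = N.+1 /\ P t) /\
    (forall t, t \in L' -> exists2 c, c <= M & c :: t \in LM).
    elim: L' {L'min} L'P => [|t L' IH] L'P; first by exists 0, [::].
    have [//|M [LM [LMP LMmin]]] := IH.
      by move=> t' t'L; apply: L'P; rewrite inE t'L orbT.
    have [st [c Pct]] := L'P t (mem_head _ _).
    exists (maxn c M), ((c :: t) :: LM); split=> t'; rewrite inE.
      by case/predU1P => [->|/LMP //]; rewrite /= st.
    case/predU1P => [->|/LMmin[d dM dLM]].
      by exists c; rewrite ?leq_maxl // mem_head.
    by exists d; rewrite ?inE ?dLM ?orbT // leq_max dM orbT.
  exists M, LM; split=> // a s Ma ss Pas.
  have [|t tL ts] := L'min s ss; first by exists a.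
  have [c cM cLM] := LMmin t tL.
  by exists (c :: t) => // -[|i] /=; [exact: leq_trans Ma | exact: ts].
have [LA [LAP LAmin]] : exists LA : seq (seq nat),
    (forall t, t \in LA -> size t = N.+1 /\ P t) /\
    (forall a s, a < M -> size s = N -> P (a :: s) ->
      exists2 t, t \in LA & forall i, nth 0 t i <= nth 0 (a :: s) i).
  elim: M {LMmin} => [|M [LA [LAP LAmin]]]; first by exists [::].
  have [L [LP Lmin]] := IHN (fun t => P (M :: t)).
  exists (map (cons M) L ++ LA); split.
    move=> t; rewrite mem_cat => /orP[/mapP[t' /LP[st' Pt'] ->]|/LAP //].
    by rewrite /= st'.
  move=> a s; rewrite ltnS leq_eqVlt => /predU1P[-> ss Ps|aM ss Ps].
    have [t tL ts] := Lmin s ss Ps; exists (M :: t); last by case.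
    by rewrite mem_cat map_f.
  have [t tL ts] := LAmin a s aM ss Ps.
  by exists t => //; rewrite mem_cat tL orbT.
exists (LM ++ LA); split.
  by move=> t; rewrite mem_cat => /orP[/LMP|/LAP].
move=> [//|a s] [ss] Ps; have [aM|Ma] := ltnP a M.
  have [t tL ts] := LAmin a s aM ss Ps.
  by exists t => //; rewrite mem_cat tL orbT.
have [t tL ts] := LMmin a s Ma ss Ps.
by exists t => //; rewrite mem_cat tL.
Qed.

Import GRing.Theory.
Local Open Scope fset_scope.
Local Open Scope ring_scope.

(** * Ideals generated by binomials *)

Section IdealGen.
Variable R : comRingType.
Implicit Types (S : seq R) (p q : R).

Lemma in_ideal_gen0 S : in_ideal_gen S 0.
Proof. by exists [::]; rewrite big1 // => i _; rewrite nth_nil mul0r. Qed.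

Lemma in_ideal_genD S p q :
  in_ideal_gen S p -> in_ideal_gen S q -> in_ideal_gen S (p + q).
Proof.
case=> c -> [d ->]; exists (mkseq (fun i => c`_i + d`_i) (size S)).
rewrite -big_split /=; apply: eq_bigr => i _.
by rewrite nth_mkseq // mulrDl.
Qed.

Lemma in_ideal_genM S p q : in_ideal_gen S q -> in_ideal_gen S (p * q).
Proof.
case=> c ->; exists (mkseq (fun i => p * c`_i) (size S)).
rewrite mulr_sumr; apply: eq_bigr => i _.
by rewrite nth_mkseq // mulrA.
Qed.

Lemma in_ideal_genN S q : in_ideal_gen S q -> in_ideal_gen S (- q).
Proof. by rewrite -mulN1r; exact: in_ideal_genM. Qed.

Lemma in_ideal_gen_sum S (J : Type) (r : seq J) (P : pred J) (F : J -> R) :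
  (forall j, P j -> in_ideal_gen S (F j)) -> in_ideal_gen S (\sum_(j <- r | P j) F j).
Proof.
move=> h; apply: big_ind => //; first exact: in_ideal_gen0.
exact: in_ideal_genD.
Qed.

Lemma mem_in_ideal_gen S p : p \in S -> in_ideal_gen S p.
Proof.
move=> pS; exists (mkseq (fun i => (i == index p S)%:R) (size S)).
have iS : (index p S < size S)%N by rewrite index_mem.
rewrite (bigD1 (Ordinal iS)) //= nth_mkseq // eqxx mul1r nth_index //.
rewrite big1 ?addr0 // => i ne; rewrite nth_mkseq //.
have /negbTE -> : (i != index p S :> nat) by apply: contra ne => /eqP e; apply/eqP/val_inj.
by rewrite mul0r.
Qed.

Lemma in_ideal_gen_trans S S' p :
  (forall q, q \in S -> in_ideal_gen S' q) -> in_ideal_gen S p -> in_ideal_gen S' p.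
Proof.
move=> h [c ->]; apply: in_ideal_gen_sum => i _.
by apply/in_ideal_genM/h/mem_nth.
Qed.

End IdealGen.

Section Binomials.
Variables (k : fieldType) (m : nat).
Implicit Types (u v w : 'X_{1..m}) (S : {fset {fset 'X_{1..m}}}).

(** The order in which [enum_fset] lists a pair is not known, so [binom_of] is determined only up to
    sign. *)
Lemma binom_of_pair u v : u != v ->
  binom_of k [fset u; v] = 'X_[u] - 'X_[v] \/
  binom_of k [fset u; v] = 'X_[v] - 'X_[u].
Proof.
move=> uv; have sz : size (enum_fset [fset u; v]) = 2%N by have := cardfs2 u v; rewrite uv.
have hu : u \in enum_fset [fset u; v] by rewrite -[_ \in _]/(u \in [fset u; v]) !inE eqxx.
have hv : v \in enum_fset [fset u; v] by rewrite -[_ \in _]/(v \in [fset u; v]) !inE eqxx orbT.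
rewrite /binom_of; move: sz hu hv; case: (enum_fset _) => [|x [|y []]] //= _.
rewrite !inE => /pred2P hu /pred2P hv.
by case: hu hv uv => -> [] ->; rewrite ?eqxx //; auto.
Qed.

Lemma fset_pair (P : {fset 'X_{1..m}}) :
  #|` P| = 2%N -> exists u v, u != v /\ P = [fset u; v].
Proof.
move=> cP; have uP := fset_uniq P.
have [u [v eP]] : exists u v, enum_fset P = [:: u; v].
  by move: cP; rewrite /=; case: (enum_fset P) => [|u [|v []]] // _; exists u, v.
rewrite eP /= inE andbT in uP; exists u, v; split=> //.
by apply/fsetP => w; rewrite -[w \in P]/(w \in enum_fset P) eP !inE.
Qed.

Lemma in_ideal_binom S u v : [fset u; v] \in S ->
  in_ideal_gen (binom_polys k S) ('X_[u] - 'X_[v]).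
Proof.
have [-> _|uv uvS] := eqVneq u v; first by rewrite subrr; exact: in_ideal_gen0.
have bS : binom_of k [fset u; v] \in binom_polys k S by apply: map_f.
have h := mem_in_ideal_gen bS.
by case: (binom_of_pair uv) h => -> // /in_ideal_genN; rewrite opprB.
Qed.

Lemma in_ideal_binom_trans S T p :
  (forall P, P \in S -> #|` P| = 2%N) ->
  (forall u v, u != v -> [fset u; v] \in S -> in_ideal_gen T ('X_[u] - 'X_[v])) ->
  in_ideal_gen (binom_polys k S) p -> in_ideal_gen T p.
Proof.
move=> S2 ST; apply: in_ideal_gen_trans => _ /mapP[P PS ->].
have PS' : P \in S by [].
have [u [v [uv eP]]] := fset_pair (S2 _ PS'); rewrite eP in PS' *.
have h := ST _ _ uv PS'.
by case: (binom_of_pair uv) => -> //; rewrite -opprB; exact: in_ideal_genN.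
Qed.

End Binomials.

(** * The toric ideal *)

Section ToricMap.
Variables (k : fieldType) (n : nat) (Bs : {set {set 'I_n}}).
Implicit Types (u v w : 'X_{1..#|Bs|}) (p q : {mpoly k[#|Bs|]}).
Local Notation I := (@toric_ideal k n Bs).

Definition wt u : 'X_{1..n} :=
  (\sum_(i < #|Bs|) (\sum_(j in @Defs.basis_of n Bs i) U_(j)) *+ u i)%MM.

Lemma wtE u e : wt u e = (\sum_(i < #|Bs|) u i * (e \in @Defs.basis_of n Bs i))%N.
Proof.
rewrite mnm_sumE; apply: eq_bigr => i _; rewrite mulmnE mnm_sumE mulnC; congr (_ * _)%N.
rewrite (eq_bigr (fun j => (j == e : nat))); last by move=> j _; rewrite mnm1E.
have [ei|/negbTE ei] := boolP (e \in Defs.basis_of i).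
  by rewrite (bigD1 e) //= eqxx big1 // => j /andP[_ /negbTE ->].
by rewrite big1 // => j jB; case: eqP => // je; rewrite je ei in jB.
Qed.

Lemma wtD u v : wt (u + v) = (wt u + wt v)%MM.
Proof.
apply/mnmP => e; rewrite mnmDE !wtE -big_split /=; apply: eq_bigr => i _.
by rewrite mnmDE mulnDl.
Qed.

Lemma toric_mapX u : toric_map ('X_[u] : {mpoly k[#|Bs|]}) = 'X_[wt u].
Proof.
rewrite /toric_map comp_mpolyX -mprodXnE; apply: eq_bigr => i _.
by rewrite tnth_mktuple mprodXE.
Qed.

Lemma mcoeff_toric_map p e :
  (toric_map p)@_e = \sum_(u <- msupp p | wt u == e) p@_u.
Proof.
rewrite /toric_map comp_mpolyEX raddf_sum [RHS]big_mkcond /=; apply: eq_bigr => u _.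
rewrite -/(toric_map _) toric_mapX mcoeffZ mcoeffX.
by case: eqP; rewrite ?mulr1 ?mulr0.
Qed.

Lemma toric_binomial u v : I ('X_[u] - 'X_[v]) <-> wt u = wt v.
Proof.
have eI : toric_map ('X_[u] - 'X_[v] : {mpoly k[#|Bs|]}) = 'X_[wt u] - 'X_[wt v].
  by rewrite -!toric_mapX /toric_map comp_mpolyB.
rewrite /toric_ideal eI; split=> [/(congr1 (mcoeff (wt u)))|->]; last exact: subrr.
rewrite mcoeffB !mcoeffX eqxx mcoeff0; case: eqP => // _ /eqP.
by rewrite subr0 oner_eq0.
Qed.

(** No other monomial has the image of [u], so nothing can cancel the term of [u] in the image of
    [p]. *)
Lemma toric_mcoeff_eq0 p u :
  I p -> (forall v, wt v = wt u -> v = u) -> p@_u = 0.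
Proof.
move=> Ip uniq_u; have := mcoeff_toric_map p (wt u); rewrite Ip mcoeff0 => e.
have [up|] := boolP (u \in msupp p); last by move/memN_msupp_eq0.
rewrite e -big_filter (bigD1_seq u) ?filter_uniq ?msupp_uniq ?mem_filter ?eqxx //=.
rewrite big_filter_cond big1 ?addr0 // => v /andP[/eqP /uniq_u ->].
by rewrite eqxx.
Qed.

(** The coefficients of [p] sum to zero over each fibre of [wt], so [p] is a combination of
    binomials joining each monomial to a representative of its fibre. Representatives are taken in
    the support, so that only monomials of degree 2 occur for a quadratic [p]. *)
Lemma toric_ideal_binomials S p : I p ->
  (forall u v, u \in msupp p -> v \in msupp p -> wt u = wt v ->
     in_ideal_gen S ('X_[u] - 'X_[v])) ->
  in_ideal_gen S p.
Proof.
move=> Ip binS; set s := msupp p.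
(* The first monomial of the support in the fibre of [w]; the default of [nth] is not reached for
   [w] in the support. *)
pose rho w := nth w s (find (fun v => wt v == wt w) s).
have hasw w : w \in s -> has (fun v => wt v == wt w) s.
  by move=> ws; apply/hasP; exists w.
have rho_s w : w \in s -> rho w \in s.
  by move=> /hasw; rewrite has_find => ?; exact: mem_nth.
have rho_wt w : w \in s -> wt (rho w) = wt w.
  by move=> /hasw /(nth_find w) /eqP.
have rho_eq v w : v \in s -> w \in s -> wt v = wt w -> rho v = rho w.
  move=> vs ws e; rewrite /rho e; apply: set_nth_default.
  by rewrite -has_find; exact: hasw.
have -> : p = \sum_(w <- s) p@_w *: ('X_[w] - 'X_[rho w]).
  apply/eqP; rewrite -subr_eq0 {1}[p]mpolyE -sumrB; apply/eqP/mpolyP => v.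
  rewrite mcoeff0 raddf_sum /=.
  rewrite (eq_bigr (fun w => if rho w == v then p@_w else 0)); last first.
    move=> w _; rewrite scalerBr opprB addrC subrK mcoeffZ mcoeffX.
    by case: eqP; rewrite ?mulr1 ?mulr0.
  rewrite -big_mkcond big_seq_cond /=.
  have [vs|vNs] := boolP (v \in s); last first.
    by apply: big1 => w /andP[/rho_s + /eqP e]; rewrite e (negbTE vNs).
  have [rv|rvN] := eqVneq (rho v) v; last first.
    apply: big1 => w /andP[ws /eqP e]; case/eqP: rvN.
    by rewrite -{2}e; apply: rho_eq => //; rewrite -e rho_wt.
  (* The remaining sum runs over the fibre of [v] and is a coefficient of the image of [p]. *)
  transitivity ((toric_map p)@_(wt v)); last by rewrite Ip mcoeff0.
  rewrite mcoeff_toric_map [RHS]big_seq_cond; apply: eq_bigl => w.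
  have [ws|//] := boolP (w \in s); rewrite ?ws /=; apply/eqP/eqP => [<-|e].
    by rewrite rho_wt.
  by rewrite (rho_eq w v).
rewrite big_seq; apply: in_ideal_gen_sum => w ws.
rewrite -mul_mpolyC; apply: in_ideal_genM; apply: binS => //; first exact: rho_s.
by rewrite rho_wt.
Qed.

End ToricMap.

(** * Equal cardinality of the bases *)

Section Equicardinal.
Variables (n : nat) (Bs : {set {set 'I_n}}).

(** A basis contained in another equals it, since an exchange would need an element of an empty
    difference. Otherwise an exchange keeps the size of [B1] and shrinks [B1 :\: B2]. *)
Lemma card_bases : is_matroid_bases Bs ->
  forall B1 B2, B1 \in Bs -> B2 \in Bs -> #|B1| = #|B2|.
Proof.
case=> _ exch B1 B2; move: {2}#|_| (leqnn #|B1 :\: B2|) => d.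
elim: d B1 => [|d IHd] B1 le_d B1s B2s.
  move: le_d; rewrite leqn0 cards_eq0 setD_eq0 => B12.
  have [-> //|] := eqVneq B1 B2; rewrite eqEsubset B12 => /subsetPn[x x2 x1].
  have xD : x \in B2 :\: B1 by rewrite in_setD x1.
  have [y] := exch _ _ B2s B1s _ xD.
  by case/setDP => y1; rewrite (subsetP B12 y y1).
have [e|[x xD]] := set_0Vmem (B1 :\: B2); first by apply: IHd; rewrite // e cards0.
have [y yD B1's] := exch _ _ B1s B2s _ xD.
case/setDP: (xD) => x1 x2; case/setDP: (yD) => y2 y1.
have <- : #|(B1 :\ x) :|: [set y]| = #|B1|.
  rewrite setUC cardsU1 (cardsD1 x B1) x1 !inE (negbTE y1) andbF //.
apply: IHd => //; rewrite -ltnS; apply: leq_trans le_d.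
apply: proper_card; apply/properP; split.
  by apply/subsetP => z; rewrite !inE => /andP[z2 /orP[/andP[_ ->]|/eqP e]]; [rewrite z2|rewrite e y2 in z2].
by exists x => //; rewrite !inE x2 eqxx /=; apply: contraNN y1 => /eqP <-.
Qed.
End Equicardinal.

(** * Pairs of bases and quadratic monomials *)

Section Pairs.
Variables (n : nat) (Bs : {set {set 'I_n}}).
Local Notation V := {X : {set {set 'I_n}} | X \in basis_pairs Bs}.
Local Notation beta := (@Defs.basis_of n Bs).
Implicit Types (X Y : V) (u v : 'X_{1..#|Bs|}).

Definition pair_mon X : 'X_{1..#|Bs|} := [multinom (beta i \in val X : nat) | i < #|Bs|].
Definition pair_label X : {set {set {set 'I_n}}} := pair_class Bs (val X).

Lemma basis_ofP i : beta i \in Bs.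
Proof. exact: (enum_valP i). Qed.

Lemma basis_of_inj : injective beta.
Proof. exact: enum_val_inj. Qed.

Lemma pair_monE X i : pair_mon X i = (beta i \in val X) :> nat.
Proof. exact: mnmE. Qed.

Lemma big_basis_of (F : {set 'I_n} -> nat) :
  (\sum_(i < #|Bs|) F (beta i) = \sum_(B in Bs) F B)%N.
Proof. by rewrite [RHS]big_enum_val. Qed.

Lemma pair_sub X : val X \subset Bs.
Proof. by have := valP X; rewrite !inE => /andP[]. Qed.

Lemma card_pair X : #|val X| = 2%N.
Proof. by have := valP X; rewrite !inE => /andP[_ /eqP]. Qed.

Lemma big_pair_mon X (F : {set 'I_n} -> nat) :
  (\sum_(i < #|Bs|) pair_mon X i * F (beta i) = \sum_(B in val X) F B)%N.
Proof.
rewrite (eq_bigr (fun i => ((beta i \in val X) * F (beta i))%N)); last first.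
  by move=> i _; rewrite pair_monE.
rewrite (big_basis_of (fun B => (B \in val X) * F B)%N) big_mkcond [RHS]big_mkcond.
apply: eq_bigr => B _; have /subsetP/(_ B) := pair_sub X.
by case: (B \in val X) => [->|_]; rewrite ?mul1n // mul0n if_same.
Qed.

Lemma mdeg_pair_mon X : mdeg (pair_mon X) = 2%N.
Proof.
have := big_pair_mon X (fun=> 1%N); rewrite sum1_card card_pair mdegE => <-.
by apply: eq_bigr => i _; rewrite muln1.
Qed.

Lemma pair_mon_inj : injective pair_mon.
Proof.
move=> X Y e; apply/val_inj/setP => B.
have [BBs|BN] := boolP (B \in Bs); last first.
  have out Z : (B \in val (Z : V)) = false.
    by apply: contraNF BN; move/subsetP: (pair_sub Z); apply.
  by rewrite !out.
have := congr1 (fun u : 'X_{1..#|Bs|} => u (enum_rank_in BBs B)) e; rewrite !pair_monE /Defs.basis_of enum_rankK_in //.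
by do 2 case: (_ \in _).
Qed.

Lemma wt_pair_mon X e : wt (pair_mon X) e = msunion (val X) e.
Proof. by rewrite wtE (big_pair_mon X (fun B => e \in B)) ffunE. Qed.

Lemma wt_pair_mon_eq X Y :
  wt (pair_mon X) = wt (pair_mon Y) <-> pair_label X = pair_label Y.
Proof.
split=> [e|].
  apply/setP => Z; rewrite !inE; congr (_ && (_ == _)).
  by apply/ffunP => x; rewrite -!wt_pair_mon e.
move=> /setP/(_ (val X)); rewrite inE eqxx (valP X) inE (valP X) /= => /esym/eqP e.
by apply/mnmP => x; rewrite !wt_pair_mon e.
Qed.

Variable r : nat.
Hypothesis r_gt0 : (0 < r)%N.
Hypothesis cardB : forall i, #|beta i| = r.

Lemma mdeg_wt u : mdeg (wt u) = (mdeg u * r)%N.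
Proof.
rewrite mdegE; under eq_bigr => e _ do rewrite wtE.
rewrite exchange_big /= mdegE big_distrl /=; apply: eq_bigr => i _.
by rewrite -big_distrr /= -(cardB i) -sum1_card [in RHS]big_mkcond.
Qed.

Lemma wt_mdeg u v : wt u = wt v -> mdeg u = mdeg v.
Proof. by move/(congr1 mdeg)/eqP; rewrite !mdeg_wt eqn_pmul2r // => /eqP. Qed.

(** Every basis occurring in [v] lies in the support of [wt v], hence inside [beta i], and equal
    cardinality makes it [beta i]. *)
Lemma wt_mul1 i d v : wt (U_(i) *+ d) = wt v -> (U_(i) *+ d)%MM = v.
Proof.
move=> e; have vi j : v j != 0%N -> j = i.
  move=> vj; apply: basis_of_inj; apply/eqP; rewrite eqEcard !cardB leqnn andbT.
  apply/subsetP => x xj; have := congr1 (fun w : 'X_{1..n} => w x) e; rewrite !wtE.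
  rewrite (bigD1 i) //= big1 => [|l /negbTE li]; last first.
    by rewrite mulmnE mnm1E eq_sym li.
  rewrite (bigD1 j) //= xj muln1 => e'; apply: contraNT vj => /negbTE xi.
  by move/eqP: e'; rewrite xi muln0 eq_sym addn_eq0 => /andP[].
have dv : d = v i.
  have := wt_mdeg e; rewrite mdegMn mdeg1 mul1n mdegE (bigD1 i) //= big1 ?addn0 //.
  by move=> j ji; apply/eqP; apply: contraNT ji => /vi ->.
apply/mnmP => j; rewrite mulmnE mnm1E; have [<-|ij] := eqVneq i j.
  by rewrite mul1n.
by rewrite mul0n; apply/esym/eqP; apply: contraNT ij => /vi ->.
Qed.

Lemma wt_low_degree u v : (mdeg u <= 1)%N -> wt u = wt v -> u = v.
Proof.
case E: (mdeg u) => [|[|//]] _ e.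
  have v0 : mdeg v = 0%N by rewrite -(wt_mdeg e).
  by move/eqP: E v0; rewrite mdeg_eq0 => /eqP -> /eqP; rewrite mdeg_eq0 => /eqP ->.
move/eqP: E => /mdeg1P[i /eqP ui]; rewrite ui in e *.
have := @wt_mul1 i 1 v; rewrite mulm1n; exact.
Qed.

Lemma quadratic_monomial u : mdeg u = 2%N ->
  (exists X, u = pair_mon X) \/ (exists i, u = U_(i) *+ 2)%MM.
Proof.
move=> u2; have [/existsP[i ui]|] := boolP [exists i, 1 < u i]%N.
  right; exists i; apply/mnmP => j; rewrite mulmnE mnm1E.
  have := u2; rewrite mdegE (bigD1 i) //=.
  have [<-|ij] := eqVneq i j; first by case: (u i) ui => [|[|[|?]]].
  rewrite (bigD1 j) ?(eq_sym j) //=.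
  by case: (u i) ui => [|[|a]] // _; case: (u j) => [//|c]; rewrite !addSn !addnS.
rewrite negb_exists => /forallP u1; left.
pose Z := [set beta i | i : 'I_#|Bs| & u i != 0%N].
have uZ i : u i = (beta i \in Z).
  rewrite mem_imset; last exact: basis_of_inj.
  by rewrite inE; have := u1 i; case: (u i) => [|[|]].
have ZP : Z \in basis_pairs Bs.
  rewrite inE; apply/andP; split.
    by apply/subsetP => _ /imsetP[i _ ->]; exact: basis_ofP.
  rewrite card_imset; last exact: basis_of_inj.
  rewrite -sum1_card big_mkcond -u2 mdegE; apply/eqP; apply: eq_bigr => i _.
  by rewrite inE; have := u1 i; case: (u i) => [|[|]].
by exists (exist _ Z ZP); apply/mnmP => i; rewrite pair_monE uZ.
Qed.

(** A square is alone in its fibre by [wt_mul1], so both monomials are squarefree. *)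
Lemma quadratic_fibre u v : mdeg u = 2%N -> wt u = wt v -> u != v ->
  exists X Y, [/\ u = pair_mon X, v = pair_mon Y & pair_label X = pair_label Y].
Proof.
move=> u2 e uv; have v2 : mdeg v = 2%N by rewrite -(wt_mdeg e).
case: (quadratic_monomial u2) => [[X uX]|[i ui]]; last first.
  by rewrite ui in e uv; rewrite (wt_mul1 e) eqxx in uv.
case: (quadratic_monomial v2) => [[Y vY]|[i vi]]; last first.
  by rewrite vi in e uv; rewrite (wt_mul1 (esym e)) eqxx in uv.
by exists X, Y; split=> //; apply/wt_pair_mon_eq; rewrite -uX -vY.
Qed.

End Pairs.

(** * Two-element sets and minimal finite sets *)

Section FsetFacts.
Variable T : choiceType.

Lemma fset_pair_eq (a b c d : T) : [fset a; b] = [fset c; d] ->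
  (a = c /\ b = d) \/ (a = d /\ b = c).
Proof.
move=> e.
have ha : a \in [fset c; d] by rewrite -e !inE eqxx.
have hb : b \in [fset c; d] by rewrite -e !inE eqxx orbT.
have hc : c \in [fset a; b] by rewrite e !inE eqxx.
have hd : d \in [fset a; b] by rewrite e !inE eqxx orbT.
move: ha hb hc hd; rewrite !inE => /pred2P[->|->] /pred2P[->|->]; auto.
- by rewrite !orbb => _ /eqP ->; left.
- by rewrite !orbb => /eqP ->; left.
Qed.

Lemma fset_pairC (a b : T) : [fset a; b] = [fset b; a].
Proof. by apply/fsetP => x; rewrite !inE orbC. Qed.

Lemma fset_minimal (Q : {fset T} -> Prop) (A : {fset T}) : Q A ->
  exists B, [/\ B `<=` A, Q B & forall C, C `<` B -> ~ Q C].
Proof.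
elim/finSet_rect: A => A IH QA.
have [[C [CA QC]]|h] := classic (exists C, C `<` A /\ Q C).
  have [B [BC QB Bmin]] := IH C CA QC; exists B; split=> //.
  exact: fsubset_trans BC (fproper_sub CA).
by exists A; split=> // C CA QC; apply: h; exists C.
Qed.

End FsetFacts.

(** * Finite generation by binomials *)

Section Graver.
Variables (k : fieldType) (n : nat) (Bs : {set {set 'I_n}}).
Local Notation I := (@toric_ideal k n Bs).
Local Notation b := #|Bs|.

(** A pair of exponent vectors is passed to [dickson] as one sequence of length [b + b], and this
    map reads back its two halves. *)
Definition mnm_of_seq (s : seq nat) : 'X_{1..b} := [multinom nth 0%N s i | i < b].

Lemma mnm_of_seq_catl (u v : 'X_{1..b}) : mnm_of_seq (take b (u ++ v)) = u.
Proof.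
apply/mnmP => i; rewrite mnmE take_size_cat ?size_tuple //.
by rewrite -mnm_nth.
Qed.

Lemma mnm_of_seq_catr (u v : 'X_{1..b}) : mnm_of_seq (drop b (u ++ v)) = v.
Proof.
apply/mnmP => i; rewrite mnmE drop_size_cat ?size_tuple //.
by rewrite -mnm_nth.
Qed.

(* The generators are the componentwise minimal pairs of distinct monomials with
   equal image (the Graver basis), finitely many by Dickson's lemma. *)
Lemma finite_binomial_generation :
  exists G : {fset {fset 'X_{1..b}}},
    (forall P, P \in G -> #|` P| = 2%N) /\ generates (binom_polys k G) I.
Proof.
pose lft s := mnm_of_seq (take b s); pose rgt s := mnm_of_seq (drop b s).
have [L [LP Lmin]] := dickson (b + b) (fun s => lft s != rgt s /\ wt (lft s) = wt (rgt s)).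
pose G := [fset [fset lft t; rgt t] | t in L].
have GP P : P \in G -> exists u v, [/\ u != v, wt u = wt v & P = [fset u; v]].
  by case/imfsetP => t /= /LP[_ [tne tw]] ->; exists (lft t), (rgt t).
have G2 P : P \in G -> #|` P| = 2%N.
  by case/GP => u [v [uv _ ->]]; rewrite cardfs2 uv.
have genG d u v : (mdeg u + mdeg v <= d)%N -> wt u = wt v ->
    in_ideal_gen (binom_polys k G) ('X_[u] - 'X_[v]).
  elim: d u v => [|d IHd] u v led e.
    move: led; rewrite leqn0 addn_eq0 !mdeg_eq0 => /andP[/eqP -> /eqP ->].
    by rewrite subrr; exact: in_ideal_gen0.
  have [->|uv] := eqVneq u v; first by rewrite subrr; exact: in_ideal_gen0.
  have := Lmin (u ++ v); rewrite size_cat !size_tuple => /(_ erefl).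
  rewrite /lft /rgt mnm_of_seq_catl mnm_of_seq_catr => /(_ (conj uv e))[t tL tmin].
  have [st [tne tw]] := LP t tL.
  have GT : [fset lft t; rgt t] \in G by apply/imfsetP; exists t.
  have leu : (lft t <= u)%MM.
    apply/mnm_lepP => i; rewrite mnmE nth_take //.
    by apply: leq_trans (tmin i) _; rewrite nth_cat size_tuple ltn_ord -mnm_nth.
  have lev : (rgt t <= v)%MM.
    apply/mnm_lepP => i; rewrite mnmE nth_drop //.
    apply: leq_trans (tmin _) _; rewrite nth_cat size_tuple ltnNge leq_addr /=.
    by rewrite addKn -mnm_nth.
  set u0 := lft t in leu tne tw GT; set v0 := rgt t in lev tne tw GT.
  (* The first summand is a multiple of a generator. The second is a multiple of a toric binomial of
     smaller total degree, because [u0] and [v0] are distinct and so not both zero. *)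
  have -> : 'X_[u] - 'X_[v] = 'X_[u - u0] * ('X_[u0] - 'X_[v0])
      + 'X_[v0] * ('X_[u - u0] - 'X_[v - v0]) :> {mpoly k[b]}.
    rewrite !mulrBr -!mpolyXD (submK leu) [(v0 + (u - u0))%MM]addmC.
    by rewrite [(v0 + (v - v0))%MM]addmC (submK lev) addrA subrK.
  apply: in_ideal_genD; apply: in_ideal_genM; first exact: in_ideal_binom.
  apply: IHd.
    rewrite -ltnS; apply: leq_trans led; rewrite -{2}(submK leu) -{2}(submK lev) !mdegD.
    rewrite addnACA -[X in (X < _)%N]addn0 ltn_add2l addn_gt0 !lt0n !mdeg_eq0 -negb_and.
    by apply: contra tne => /andP[/eqP -> /eqP ->].
  move: e; rewrite -{1}(submK leu) -{1}(submK lev) !wtD tw => /(congr1 (fun w => w - wt v0)%MM).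
  by rewrite !addmK.
exists G; split=> //; split.
  move=> _ /mapP[P PG ->]; have [u [v [uv e ->]]] := GP P PG.
  by case: (binom_of_pair k uv) => ->; apply/toric_binomial.
move=> p Ip; apply: toric_ideal_binomials Ip _ => u v _ _ e.
exact: genG (leqnn _) e.
Qed.

End Graver.

(** * Spanning forests and minimal generating sets *)

Section Trees.
Variables (k : fieldType) (n : nat) (Bs : {set {set 'I_n}}).
Local Notation I := (@toric_ideal k n Bs).
Local Notation b := #|Bs|.
Local Notation V := {X : {set {set 'I_n}} | X \in basis_pairs Bs}.
Local Notation mon := (@pair_mon n Bs).
Local Notation lab := (@pair_label n Bs).
Local Notation edge x y := [fset mon x; mon y].
Implicit Types (x y z : V) (u v w : 'X_{1..b}) (f g : {ffun V -> V}).
Implicit Types (S T : {fset {fset 'X_{1..b}}}).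

(* A monomial [mon x] has degree 2, the smallest degree of a nonzero toric
   binomial; stated so that it also holds, vacuously, for a matroid of rank 0. *)
Hypothesis quad_min : forall x w u v, u != v -> wt u = wt v ->
  mon x = (w + u)%MM -> w = 0%MM /\ exists y, v = mon y.

Variable R : {set V}.
Hypothesis R_uniq : forall r s, r \in R -> s \in R -> lab r = lab s -> r = s.
Hypothesis R_ex : forall x, exists2 r, r \in R & lab r = lab x.

Definition edges f : {fset {fset 'X_{1..b}}} :=
  [fset edge x (f x) | x in ~: R].

Lemma edgesP f P :
  reflect (exists2 x, x \notin R & P = edge x (f x)) (P \in edges f).
Proof.
apply: (iffP (imfsetP _ _ _ _)) => -[x xR ->]; exists x => //.
  by rewrite /= inE in xR.
by rewrite /= inE.
Qed.

Lemma edge_eq x y x' y' : edge x y = edge x' y' ->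
  (x = x' /\ y = y') \/ (x = y' /\ y = x').
Proof.
by case/fset_pair_eq => -[/pair_mon_inj -> /pair_mon_inj ->]; [left|right].
Qed.

(** Induction from the roots upwards: the edge from [x] to [f x] is either an edge of [g] starting
    at [x], or one from [f x] to [x]. In the latter case [f (f x) = g (f x) = x], a cycle of [f]. *)
Lemma edges_sub_inj f g : f \in forests lab R -> g \in forests lab R ->
  edges f `<=` edges g -> f = g.
Proof.
move=> fF gF /fsubsetP sub; case/forestsP: (fF) => fR fl fc.
case/forestsP: (gF) => gR _ _.
apply/ffunP => x; have [r rR] := fc x.
move: x; apply: fconnect_ind => [|x IH]; first by rewrite fR ?gR.
have [xR|xR] := boolP (x \in R); first by rewrite fR ?gR.
have /edgesP[z zR /edge_eq[[-> //]|[xz fxz]]] : edge x (f x) \in edges g.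
  by apply: sub; apply/edgesP; exists x.
rewrite -fxz in zR xz.
have cyc := forests_acyclic fF xR; case/negP: cyc.
by apply: fconnect_step; rewrite IH -xz connect0.
Qed.

(** The condition that [S] consists of binomials of the ideal, freed of signs and of the field. *)
Definition toric_pairs S :=
  (forall P, P \in S -> #|` P| = 2%N) /\
  (forall u v, [fset u; v] \in S -> wt u = wt v).

Lemma generates_toric_pairs S : (forall P, P \in S -> #|` P| = 2%N) ->
  generates (binom_polys k S) I -> toric_pairs S.
Proof.
move=> S2 [SI _]; split=> // u v uvS; have [-> //|uv] := eqVneq u v.
have : I (binom_of k [fset u; v]) by apply: SI; apply: map_f.
by case: (binom_of_pair k uv) => -> /toric_binomial.
Qed.

Lemma toric_pairs_generates S : toric_pairs S ->
  (forall p, I p -> in_ideal_gen (binom_polys k S) p) ->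
  generates (binom_polys k S) I.
Proof.
case=> S2 Sw; split=> // _ /mapP[P PS ->].
have PS' : P \in S by [].
have [u [v [uv eP]]] := fset_pair (S2 _ PS'); rewrite eP in PS' *.
have e := Sw _ _ PS'.
by case: (binom_of_pair k uv) => ->; apply/toric_binomial.
Qed.

Lemma edges_toric_pairs f : f \in forests lab R -> toric_pairs (edges f).
Proof.
move=> fF; case/forestsP: (fF) => _ fl _; split=> [P|u v] /edgesP[x xR].
  move=> ->; rewrite cardfs2; case: eqP => // /pair_mon_inj e.
  by have := forests_acyclic fF xR; rewrite -e connect0.
have e : wt (mon x) = wt (mon (f x)) by apply/wt_pair_mon_eq.
by case/fset_pair_eq => -[-> ->].
Qed.

(* The sum of the coefficients at the monomials [mon x], [x \in A], vanishes on
   the ideal generated by [S]: a multiple of a binomial of [S] has no such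
   monomial unless it is a constant multiple of an edge. *)
Lemma closed_under_edges S (A : {set V}) x y : toric_pairs S ->
  (forall x y, edge x y \in S -> x \in A -> y \in A) ->
  in_ideal_gen (binom_polys k S) ('X_[mon x] - 'X_[mon y]) ->
  x \in A -> y \in A.
Proof.
case=> S2 Sw clA inS xA.
pose lam (p : {mpoly k[b]}) : k := \sum_(x in A) p@_(mon x).
have lamX u : lam 'X_[u] = (u \in [seq mon z | z in A])%:R.
  rewrite /lam; under eq_bigr => z _ do rewrite mcoeffX.
  have [/imageP[z zA ->]|uN] := boolP (u \in _).
    rewrite (bigD1 z) //= eqxx big1 ?addr0 // => z' /andP[_ z'z].
    by rewrite (inj_eq (@pair_mon_inj _ _)) eq_sym (negbTE z'z).
  apply: big1 => z zA; case: eqP => // e.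
  by case/negP: uN; rewrite e; apply: image_f.
have lamD : {morph lam : p q / p + q}.
  by move=> p q; rewrite /lam -big_split; apply: eq_bigr => z _; exact: mcoeffD.
have lamN p : lam (- p) = - lam p.
  by rewrite /lam -sumrN; apply: eq_bigr => z _; exact: mcoeffN.
have lam0 : lam 0 = 0 by rewrite /lam big1 // => z _; exact: mcoeff0.
have lamZ c p : lam (c *: p) = c * lam p.
  by rewrite /lam mulr_sumr; apply: eq_bigr => z _; exact: mcoeffZ.
have lam_sum (J : Type) (s : seq J) (F : J -> {mpoly k[b]}) :
    lam (\sum_(j <- s) F j) = \sum_(j <- s) lam (F j) := big_morph lam lamD lam0 _ _ _.
have shift w u v : u != v -> [fset u; v] \in S ->
    (w + u)%MM \in [seq mon z | z in A] -> (w + v)%MM \in [seq mon z | z in A].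
  move=> uv uvS /imageP[z zA e].
  have [w0 [z' vz']] := quad_min uv (Sw _ _ uvS) (esym e).
  rewrite w0 !add0m in e *; rewrite vz'; apply: image_f; apply: clA zA.
  by rewrite -e -vz'.
have lam_shift w u v : u != v -> [fset u; v] \in S -> lam 'X_[w + u] = lam 'X_[w + v].
  move=> uv uvS; rewrite !lamX; congr (_%:R); congr nat_of_bool.
  apply/idP/idP; first exact: shift.
  by apply: shift; [rewrite eq_sym | rewrite fset_pairC].
have lam_binom c u v : u != v -> [fset u; v] \in S -> lam (c * ('X_[u] - 'X_[v])) = 0.
  move=> uv uvS; rewrite [c]mpolyE big_distrl lam_sum big1 // => w _ /=.
  rewrite -scalerAl lamZ mulrBr -!mpolyXD lamD lamN.
  by rewrite (lam_shift w _ _ uv uvS) subrr mulr0.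
have {inS} : lam ('X_[mon x] - 'X_[mon y]) = 0.
  case: inS => c ->; rewrite (big_morph lam lamD lam0) big1 // => i _.
  have /mapP[P PS ->] := mem_nth 0 (ltn_ord i).
  have PS' : P \in S by [].
  have [u [v [uv eP]]] := fset_pair (S2 _ PS'); rewrite eP in PS' *.
  case: (binom_of_pair k uv) => ->; first exact: lam_binom.
  by apply: lam_binom; [rewrite eq_sym | rewrite fset_pairC].
rewrite lamD lamN !lamX image_f // => /eqP; rewrite subr_eq0.
have [/imageP[z zA /pair_mon_inj -> //]|_] := boolP (mon y \in _).
by rewrite oner_eq0.
Qed.

Lemma generates_closed S (A : {set V}) x y : toric_pairs S ->
  generates (binom_polys k S) I ->
  (forall x y, edge x y \in S -> x \in A -> y \in A) ->
  lab x = lab y -> x \in A -> y \in A.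
Proof.
move=> Sp [_ Sgen] clA e; apply: closed_under_edges Sp clA _.
by apply/Sgen/toric_binomial/wt_pair_mon_eq.
Qed.

(** The binomials telescope along the paths from [x] and [y] to the root that their class shares. *)
Lemma edges_connect f (J : seq {mpoly k[b]}) x y : f \in forests lab R ->
  (forall x, x \notin R -> in_ideal_gen J ('X_[mon x] - 'X_[mon (f x)])) ->
  lab x = lab y -> in_ideal_gen J ('X_[mon x] - 'X_[mon y]).
Proof.
case/forestsP => fR fl fc Jf e.
have to_root z r : fconnect f z r -> in_ideal_gen J ('X_[mon z] - 'X_[mon r]).
  move: z; apply: fconnect_ind => [|z Jz].
    by rewrite subrr; exact: in_ideal_gen0.
  have [zR|zR] := boolP (z \in R); first by rewrite fR in Jz.
  by have := in_ideal_genD (Jf z zR) Jz; rewrite addrA subrK.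
have [r rR xr] := fc x; have [s sR ys] := fc y.
have rs : r = s by apply: R_uniq => //; rewrite (fconnect_lab fl xr) (fconnect_lab fl ys).
have := in_ideal_genD (to_root x r xr) (in_ideal_genN (to_root y s ys)).
by rewrite rs opprB addrA subrK.
Qed.

(** The forest grows from the roots. While the set [A] of vertices reached so far is not closed,
    some edge of [S] leaves it, and the outer endpoint gets the inner one as parent. A closed [A]
    contains every class by [generates_closed]. *)
Lemma spanning_forest S : toric_pairs S -> generates (binom_polys k S) I ->
  exists2 f, f \in forests lab R & edges f `<=` S.
Proof.
move=> Sp Sgen.
pose good (A : {set V}) f := [/\ R \subset A,
  {in R, forall x, f x = x}, forall x, lab (f x) = lab x,
  {in A, forall x, f x \in A /\ exists2 r, r \in R & fconnect f x r} &
  {in A, forall x, x \notin R -> edge x (f x) \in S}].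
suff ext d A f : (#|~: A| <= d)%N -> good A f -> exists g, good setT g.
  have [|g [_ gR gl gc gS]] := ext _ R [ffun x => x] (leqnn _).
    split=> //; first by move=> x _; rewrite ffunE.
    - by move=> x; rewrite ffunE.
    - by move=> x xR; rewrite ffunE; split=> //; exists x.
    - by move=> x ->.
  exists g; first by apply/forestsP; split=> // x; have [] := gc x (in_setT x).
  by apply/fsubsetP => _ /edgesP[x xR ->]; apply: gS.
elim: d A f => [|d IHd] A f le_d Af.
  move: le_d; rewrite leqn0 cards_eq0 -setCT (inj_eq (inv_inj (@setCK _))) => /eqP AT.
  by exists f; rewrite -AT.
have [cl|] := boolP [forall x in A, forall y, (edge x y \in S) ==> (y \in A)].
  exists f; suff -> : [set: V] = A by [].
  apply/setP => y; rewrite inE; apply/esym; have [r rR e] := R_ex y.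
  case: Af => /subsetP RA _ _ _ _; move: (RA r rR).
  apply: generates_closed Sp Sgen _ e => x z xz xA.
  by move/forall_inP/(_ x xA)/forallP/(_ z)/implyP: cl; apply.
rewrite negb_forall => /existsP[x]; rewrite negb_imply => /andP[xA].
rewrite negb_forall => /existsP[y]; rewrite negb_imply => /andP[xyS yA].
case: Af => RA fR fl fc fS.
apply: (IHd (y |: A) (upd f y x)).
  rewrite -ltnS; apply: leq_trans le_d; apply: proper_card.
  apply/properP; split; first by rewrite setCS subsetUr.
  by exists y; rewrite !inE ?eqxx.
have yR : y \notin R by apply: contra yA; apply/subsetP.
have old z r : z \in A -> fconnect f z r -> fconnect (upd f y x) z r.
  move=> + zr; move: z zr; apply: fconnect_ind => // z IH zA.
  have zy : z != y by apply: contraNneq yA => <-.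
  by apply: fconnect_step; rewrite upd_diff //; apply: IH; case: (fc z zA).
have lxy : lab x = lab y by apply/wt_pair_mon_eq; case: Sp => _; apply.
split.
- by apply: subset_trans RA (subsetUr _ _).
- by move=> z zR; rewrite upd_diff ?fR //; apply: contraNneq yR => <-.
- by move=> z; rewrite ffunE; case: eqP => [->|_].
- move=> z /setU1P[->|zA].
    rewrite upd_same; split; first by rewrite inE xA orbT.
    have [_ [r rR xr]] := fc x xA; exists r; first exact: rR.
    by apply: fconnect_step; rewrite upd_same; exact: old.
  have zy : z != y by apply: contraNneq yA => <-.
  have [fzA [r rR zr]] := fc z zA; split; first by rewrite upd_diff // inE fzA orbT.
  by exists r; [exact: rR | exact: old].
- move=> z /setU1P[->|zA] zR; first by rewrite upd_same fset_pairC.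
  by rewrite upd_diff ?fS //; apply: contraNneq yA => <-.
Qed.

Lemma minimal_over_edges f T : f \in forests lab R ->
  (forall P, P \in T -> #|` P| = 2%N) -> generates (binom_polys k T) I ->
  (forall x y, edge x y \in T -> edge x y \in edges f) ->
  (forall T', T' `<` T -> edges f `<=` T' -> ~ generates (binom_polys k T') I) ->
  minimal_binomial_gen_set I T.
Proof.
move=> fF T2 Tgen only Tmin; split=> //; split=> // T' T'T gT'.
apply: (Tmin _ T'T _ gT'); apply/fsubsetP => _ /edgesP[x xR ->].
have T'sub := fproper_sub T'T.
have T'2 P : P \in T' -> #|` P| = 2%N by move/(fsubsetP T'sub)/T2.
apply/negPn/negP => xNT'; have [fR fl _] := forestsP _ _ _ fF.
have := @generates_closed T' [set z | fconnect f z x] x (f x)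
  (generates_toric_pairs T'2 gT') gT' _ (esym (fl x)).
rewrite !inE connect0 (negbTE (forests_acyclic fF xR)) => clA.
suff : false by []; apply: clA => // y z yzT'; rewrite !inE.
have /edgesP[t tR /edge_eq[[yt zt]|[yt zt]]] := only _ _ (fsubsetP T'sub _ yzT').
  rewrite zt -yt; case: (eqVneq y x) => [yx|yx yx'].
    by rewrite zt -yt yx (negbTE xNT') in yzT'.
  have := iter_findex yx'; case: (findex f y x) => [/= e|i].
    by rewrite e eqxx in yx.
  by rewrite iterSr => <-; exact: fconnect_iter.
by rewrite yt zt; exact: fconnect_step.
Qed.

(** In a finite binomial generating set, the edges are replaced by those of [f], which generate
    them. The result is then shrunk while keeping the edges of [f]. *)
Lemma forest_extends f : f \in forests lab R ->
  exists T, [/\ minimal_binomial_gen_set I T, edges f `<=` T &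
                forall x y, edge x y \in T -> edge x y \in edges f].
Proof.
move=> fF; have [G [G2 Ggen]] := finite_binomial_generation k Bs.
have Gp := generates_toric_pairs G2 Ggen; case: (Gp) => _ Gw.
pose quad (P : {fset 'X_{1..b}}) := [exists x, exists y, P == edge x y].
pose T0 := edges f `|` [fset P in G | ~~ quad P].
have [f2 fw] := edges_toric_pairs fF.
have T02 P : P \in T0 -> #|` P| = 2%N.
  by rewrite !inE => /orP[/f2 //|/andP[/G2]].
have T0p : toric_pairs T0.
  by split=> // u v; rewrite !inE => /orP[/fw //|/andP[/Gw]].
have only x y : edge x y \in T0 -> edge x y \in edges f.
  rewrite !inE => /orP[//|/andP[_ /negP[]]].
  by apply/existsP; exists x; apply/existsP; exists y.
have T0gen : generates (binom_polys k T0) I.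
  apply: toric_pairs_generates T0p _ => p /(proj2 Ggen).
  apply: in_ideal_binom_trans G2 _ => u v uv uvG.
  have [/existsP[x /existsP[y /eqP e]]|nq] := boolP (quad [fset u; v]); last first.
    by apply: in_ideal_binom; rewrite !inE uvG nq orbT.
  have lxy : lab x = lab y.
    by apply/wt_pair_mon_eq/Gw; rewrite -e.
  have Txy z t : lab z = lab t -> in_ideal_gen (binom_polys k T0) ('X_[mon z] - 'X_[mon t]).
    apply: edges_connect fF _ => {z t} z zR; apply: in_ideal_binom.
    by rewrite inE; apply/orP; left; apply/edgesP; exists z.
  by case/fset_pair_eq: e => -[-> ->]; apply: Txy.
pose Q T := edges f `<=` T /\ generates (binom_polys k T) I.
have [|T [TT0 [fT Tgen] Tmin]] := @fset_minimal _ Q T0; first by split=> //; exact: fsubsetUl.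
have T2 P : P \in T -> #|` P| = 2%N by move/(fsubsetP TT0)/T02.
have onlyT x y : edge x y \in T -> edge x y \in edges f.
  by move/(fsubsetP TT0)/only.
exists T; split=> //; apply: minimal_over_edges fF T2 Tgen onlyT _ => T' T'T fT' gT'.
exact: Tmin T' T'T (conj fT' gT').
Qed.

(** * Ideals generated by quadratics *)

Section Quadratics.
Hypothesis quad_fibre : forall u v, mdeg u = 2%N -> wt u = wt v -> u != v ->
  exists x y, [/\ u = mon x, v = mon y & lab x = lab y].
Hypothesis quads : generated_by_quadratics I.

(** Each quadratic generator is a combination of toric binomials on its own support, and by
    [quad_fibre] the nonzero ones join pairs of one class. *)
Lemma quadratics_generate (J : seq {mpoly k[b]}) :
  (forall x y, lab x = lab y -> in_ideal_gen J ('X_[mon x] - 'X_[mon y])) ->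
  forall p, I p -> in_ideal_gen J p.
Proof.
move=> Jlab p Ip; case: quads => S [[SI Sgen] /allP S2].
apply: in_ideal_gen_trans (Sgen p Ip) => q qS.
apply: toric_ideal_binomials (SI q qS) _ => u v uq vq e.
have [->|uv] := eqVneq u v; first by rewrite subrr; exact: in_ideal_gen0.
have u2 : mdeg u = 2%N by exact: (dhomogP _ _ _ (S2 q qS)).
by have [x [y [-> -> exy]]] := quad_fibre u2 e uv; exact: Jlab.
Qed.

Lemma edges_generate f : f \in forests lab R -> generates (binom_polys k (edges f)) I.
Proof.
move=> fF; apply: toric_pairs_generates (edges_toric_pairs fF) _.
apply: quadratics_generate => x y; apply: edges_connect fF _ => z zR.
by apply: in_ideal_binom; apply/edgesP; exists z.
Qed.

(** A minimal set contains the edges of a spanning forest, which already generate, so it equals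
    them. *)
Lemma minimal_quadratic T :
  minimal_binomial_gen_set I T <-> exists2 f, f \in forests lab R & T = edges f.
Proof.
split=> [[T2 [Tgen Tmin]]|[f fF ->]].
  have [f fF fT] := spanning_forest (generates_toric_pairs T2 Tgen) Tgen.
  exists f => //; case: (eqVfproper fT) => [//|fT'].
  by case: (Tmin _ fT'); exact: edges_generate.
have [f2 _] := edges_toric_pairs fF.
apply: minimal_over_edges fF f2 (edges_generate fF) _ _ => // T' T'f fT'.
by have := fsub_proper_trans fT' T'f; rewrite (negbTE (fproper_irrefl _)).
Qed.

Lemma quadratic_generating_seq :
  exists S : seq {mpoly k[b]}, generates S I /\ size S = #|~: R|.
Proof.
have [G [G2 Ggen]] := finite_binomial_generation k Bs.
(* Any generating set serves here; it only provides the existence of a forest. *)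
have [f fF _] := spanning_forest (generates_toric_pairs G2 Ggen) Ggen.
exists [seq 'X_[mon x] - 'X_[mon (f x)] | x in ~: R]; split; last by rewrite size_image.
split=> [_ /imageP[x xR ->]|].
  by apply/toric_binomial/wt_pair_mon_eq; case/forestsP: fF.
apply: quadratics_generate => x y; apply: edges_connect fF _ => z zR.
by apply: mem_in_ideal_gen; apply: image_f; rewrite inE.
Qed.

End Quadratics.

(** If [mon x = w + u] with [w] nonzero, then by [quad_min] the monomial [u] is alone in its fibre,
    so its coefficient in [q] vanishes. Only the constant term of [c] contributes. *)
Lemma mcoeff_mul_pair_mon (c q : {mpoly k[b]}) x :
  I q -> (c * q)@_(mon x) = c@_0%MM * q@_(mon x).
Proof.
move=> Iq; rewrite -{1}[c](subrK (c@_0%MM)%:MP) mulrDl mcoeffD mcoeffCM.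
rewrite mcoeffM big1 ?add0r // => -[[w ?] [u ?]] /= /eqP e.
have [->|w0] := eqVneq w 0%MM; first by rewrite mcoeffB mcoeffC eqxx mulr1 subrr mul0r.
rewrite (toric_mcoeff_eq0 Iq) ?mulr0 // => v wv; have [-> //|vu] := eqVneq v u.
rewrite eq_sym in vu.
by have [w0'] := quad_min vu (esym wv) e; rewrite w0' eqxx in w0.
Qed.

(** The binomials joining each nonroot to its root have the identity as matrix of coefficients at
    the nonroots. Expanding them in [S] factors this identity through dimension [size S]. *)
Lemma generators_lower_bound (S : seq {mpoly k[b]}) :
  generates S I -> (#|~: R| <= size S)%N.
Proof.
case=> SI Sgen; have [rep repR replab] := fin_all_exists2 R_ex.
have [|C CE] := @fin_all_exists V (fun=> seq {mpoly k[b]})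
    (fun x c => 'X_[mon x] - 'X_[mon (rep x)] = \sum_(i < size S) c`_i%R * S`_i%R).
  by move=> x; apply: Sgen; apply/toric_binomial/wt_pair_mon_eq.
pose ev (i : 'I_#|~: R|) : V := enum_val i.
pose A := \matrix_(i < #|~: R|, j < size S) ((C (ev i))`_j%R)@_0%MM.
pose B := \matrix_(j < size S, i < #|~: R|) (S`_j%R)@_(mon (ev i)).
apply: (@mulmx1_min _ _ _ A B); apply/matrixP => i i'; rewrite !mxE.
transitivity (('X_[mon (ev i)] - 'X_[mon (rep (ev i))] : {mpoly k[b]})@_(mon (ev i'))).
  rewrite CE raddf_sum /=; apply: eq_bigr => j _.
  by rewrite !mxE mcoeff_mul_pair_mon //; apply/SI/mem_nth.
rewrite mcoeffB !mcoeffX !(inj_eq (@pair_mon_inj _ _)) (inj_eq enum_val_inj).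
have : ev i' \in ~: R by exact: enum_valP.
case: (rep _ =P _) => [<-|_ _]; last by rewrite subr0.
by rewrite inE repR.
Qed.

End Trees.

(** * Counting pairs and classes *)

Section Counting.
Variables (n : nat) (Bs : {set {set 'I_n}}).
Local Notation V := {X : {set {set 'I_n}} | X \in basis_pairs Bs}.
Local Notation lab := (@pair_label n Bs).

Lemma pair_classesE : pair_classes Bs = [set lab x | x : V].
Proof.
apply/setP => C; apply/imsetP/imsetP => [[X XP ->]|[X _ ->]].
  by exists (exist _ X XP); rewrite ?inE.
by exists (val X); first exact: valP.
Qed.

Lemma card_label_class C : C \in pair_classes Bs -> #|label_class lab C| = #|C|.
Proof.
case/imsetP => X XP ->; rewrite -(card_imset _ val_inj); apply: eq_card => Y.
apply/imsetP/idP => [[Z]|YC].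
  rewrite inE => /eqP <- ->; by rewrite inE eqxx (valP Z).
have YP : Y \in basis_pairs Bs by move: YC; rewrite inE => /andP[].
exists (exist _ Y YP) => //; rewrite inE; apply/eqP/setP => Z.
by move: YC; rewrite !inE => /andP[_ /eqP ->].
Qed.

Lemma label_transversal : exists R : {set V},
  [/\ forall r s, r \in R -> s \in R -> lab r = lab s -> r = s,
      forall x, exists2 r, r \in R & lab r = lab x & #|R| = #|pair_classes Bs|].
Proof.
(* The predicate of [pick] involves [x] only through its label, so the choice is constant on each
   class. *)
pose rep x := odflt x [pick y | lab y == lab x].
have rep_lab x : lab (rep x) = lab x.
  by rewrite /rep; case: pickP => [y /eqP //|/(_ x)]; rewrite eqxx.
have rep_eq x y : lab x = lab y -> rep x = rep y.
  by rewrite /rep => ->; case: pickP => // /(_ y); rewrite eqxx.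
have R_uniq r s : r \in [set rep x | x : V] -> s \in [set rep x | x : V] -> lab r = lab s -> r = s.
  by case/imsetP => x _ -> /imsetP[y _ ->]; rewrite !rep_lab; exact: rep_eq.
exists ([set rep x | x : V]); split=> // [x|]; first by exists (rep x); rewrite ?imset_f.
rewrite pair_classesE -(card_in_imset (f := lab)) => [|r s rR sR]; last exact: R_uniq.
by rewrite -imset_comp; congr #|pred_of_set _|; apply: eq_imset => x; rewrite /= rep_lab.
Qed.

(** There are ['C(#|Bs|, 2)] pairs, half of [#|Bs| ^ 2 - #|Bs|], so the integer division is
    exact. *)
Lemma card_nonroots (R : {set V}) : #|R| = #|pair_classes Bs| ->
  (#|~: R| = (#|Bs| ^ 2 - #|Bs| - 2 * #|pair_classes Bs|) %/ 2)%N.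
Proof.
move=> cR; have cV : #|{: V}| = 'C(#|Bs|, 2).
  by rewrite card_sig -cards_draws; apply: eq_card => X; rewrite !inE.
have -> : (#|Bs| ^ 2 - #|Bs| = 'C(#|Bs|, 2) * 2)%N.
  rewrite -[X in (_ * X)%N]/(2`!) bin_ffact !ffactnS ffactn0 muln1 -mulnn.
  by rewrite -subn1 mulnBr muln1.
by rewrite -cR [(2 * _)%N]mulnC -mulnBl mulnK // cardsCs setCK cV.
Qed.

End Counting.

(** * Rank zero and positive rank *)

Section MatroidRank.
Variables (n : nat) (Bs : {set {set 'I_n}}).
Hypothesis matroid : is_matroid_bases Bs.
Local Notation V := {X : {set {set 'I_n}} | X \in basis_pairs Bs}.

Lemma loopless_rank : set0 \notin Bs ->
  exists2 r, (0 < r)%N & forall i, #|@Defs.basis_of n Bs i| = r.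
Proof.
move=> B0; have [/set0Pn[B BBs] _] := matroid; exists #|B|.
  by rewrite card_gt0; apply: contraNneq B0 => <-.
by move=> i; apply: (card_bases matroid) => //; exact: basis_ofP.
Qed.

Lemma rank0_bases B : set0 \in Bs -> B \in Bs -> B = set0.
Proof.
by move=> B0 BBs; apply/eqP; rewrite -cards_eq0 (card_bases matroid BBs B0) cards0.
Qed.

(** In rank 0 the empty set is the only basis and there are no pairs. In positive rank, [u] has
    degree at least 2 by [wt_low_degree], which leaves nothing for [w]. *)
Lemma matroid_quad_min (X : V) (w u v : 'X_{1..#|Bs|}) : u != v -> wt u = wt v ->
  pair_mon X = (w + u)%MM -> w = 0%MM /\ exists Y, v = pair_mon Y.
Proof.
move=> uv e eX; have B0 : set0 \notin Bs.
  apply/negP => B0; have : (#|val X| <= #|[set (set0 : {set 'I_n})]|)%N.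
    apply/subset_leq_card/subsetP => B /(subsetP (pair_sub X)) /(rank0_bases B0) ->.
    by rewrite inE.
  by rewrite card_pair cards1.
have [r r_gt0 cardB] := loopless_rank B0.
have [u1|u2] := leqP (mdeg u) 1.
  by rewrite (wt_low_degree r_gt0 cardB u1 e) eqxx in uv.
have := mdeg_pair_mon X; rewrite eX mdegD => d2.
have w0 : mdeg w = 0%N by case: (mdeg w) (mdeg u) u2 d2 => [//|d] [|[|?]] // _; rewrite addSn !addnS.
split; first by apply/eqP; rewrite -mdeg_eq0 w0.
have {}u2 : mdeg u = 2%N by rewrite -d2 w0.
by have [Y [Z [_ -> _]]] := quadratic_fibre r_gt0 cardB u2 e uv; exists Z.
Qed.

(** In rank 0 the variable of the empty basis maps to 1, so the variable minus 1 lies in the ideal;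
    its constant term is nonzero, unlike that of any combination of quadratics. *)
Lemma quadratics_loopless (k : fieldType) :
  generated_by_quadratics (@toric_ideal k n Bs) -> set0 \notin Bs.
Proof.
case=> S [[_ Sgen] /allP S2]; apply/negP => B0.
have basis0 i : @Defs.basis_of n Bs i = set0 by apply: rank0_bases B0 (basis_ofP i).
pose i : 'I_#|Bs| := enum_rank_in B0 set0.
have : toric_ideal ('X_[U_(i)] - 'X_[0%MM] : {mpoly k[#|Bs|]}).
  apply/toric_binomial/mnmP => e; rewrite !wtE.
  by rewrite !big1 // => j _; rewrite basis0 inE muln0.
case/Sgen => c /(congr1 (mcoeff 0%MM)).
rewrite mcoeffB !mcoeffX eqxx raddf_sum /= big1 => [|j _]; last first.
  have hq := dhomogP _ _ _ (S2 _ (mem_nth 0 (ltn_ord j))).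
  rewrite mcoeffM big1 // => -[[u ?] [v ?]] /= /eqP e.
  rewrite (@memN_msupp_eq0 _ _ _ v) ?mulr0 //; apply/negP => vS.
  have v2 : mdeg v = 2%N := hq v vS.
  by have := congr1 mdeg e; rewrite mdeg0 mdegD v2 addn2.
have -> : (U_(i) == 0 :> 'X_{1..#|Bs|})%MM = false by rewrite -mdeg_eq0 mdeg1.
by move/eqP; rewrite sub0r oppr_eq0 oner_eq0.
Qed.

End MatroidRank.

Theorem theorem4p1 (k : fieldType) (n : nat) (Bs : {set {set 'I_n}}) :
  is_matroid_bases Bs ->
  let b := #|Bs| in
  let s := #|pair_classes Bs| in
  let I := @toric_ideal k n Bs in
  let nu_bound := (\prod_(C in pair_classes Bs) #|C| ^ (#|C| - 2))%N in
  (* (1) mu(I_M) >= (b^2 - b - 2s)/2 *)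
  (forall S : seq {mpoly k[#|Bs|]}, generates S I ->
     ((b ^ 2 - b - 2 * s) %/ 2 <= size S)%N) /\
  (* (2) nu(I_M) >= prod_i r_i^(r_i - 2) : at least that many distinct
         minimal binomial generating sets *)
  (exists L : seq {fset {fset 'X_{1..#|Bs|}}},
     uniq L /\ size L = nu_bound /\
     (forall S, S \in L -> minimal_binomial_gen_set I S)) /\
  (* equality in both cases when I_M is generated by quadratics *)
  (generated_by_quadratics I ->
     (exists S : seq {mpoly k[#|Bs|]}, generates S I /\
        size S = ((b ^ 2 - b - 2 * s) %/ 2)%N) /\
     (exists L : seq {fset {fset 'X_{1..#|Bs|}}},
        uniq L /\ size L = nu_bound /\
        (forall S, minimal_binomial_gen_set I S <-> S \in L))).
Proof.
move=> matroid b s I nu_bound.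
have [R [R_uniq R_ex cR]] := label_transversal Bs.
have quad_min := matroid_quad_min matroid.
have card_forest : #|forests (@pair_label n Bs) R| = nu_bound.
  rewrite /nu_bound (eq_bigr (fun C => #|label_class (@pair_label n Bs) C| ^
    (#|label_class (@pair_label n Bs) C| - 2))%N) => [|C CP]; last first.
    by rewrite card_label_class.
  rewrite pair_classesE; apply: card_rooted_trees => c /imsetP[x _ ->].
  have [r rR er] := R_ex x; apply/eqP/cards1P; exists r; apply/setP => y.
  rewrite !inE; apply/andP/eqP => [[yR /eqP ey]|->]; last by rewrite rR er.
  by apply: R_uniq => //; rewrite ey er.
rewrite -(card_nonroots cR); split; first exact: generators_lower_bound quad_min R R_ex.
split=> [|quads].
  (* The membership of [f] is placed under the existential so that [T] can be chosen for all
     functions at once, with a dummy value off the forests. *)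
  have ext f : exists T, f \in forests (@pair_label n Bs) R ->
      [/\ minimal_binomial_gen_set I T, edges R f `<=` T &
        forall x y, [fset pair_mon x; pair_mon y] \in T ->
                    [fset pair_mon x; pair_mon y] \in edges R f].
    have [fF|_] := boolP (f \in forests (@pair_label n Bs) R); last by exists fset0.
    by have [T hT] := @forest_extends k n Bs quad_min R R_uniq f fF; exists T.
  have [T TP] := fin_all_exists ext.
  exists [seq T f | f in forests (@pair_label n Bs) R]; split; [|split].
  - rewrite map_inj_in_uniq ?enum_uniq // => f g; rewrite !mem_enum => fF gF eT.
    (* The edges of [f] lie in [T f = T g], whose only edges between pair monomials are those of
       [g]. *)
    apply: (edges_sub_inj fF gF); apply/fsubsetP => P Pf.
    have [_ /fsubsetP fT _] := TP f fF; have [_ _ only] := TP g gF.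
    case/edgesP: (Pf) (fT P Pf) => x _ ->; rewrite eT; exact: only.
  - by rewrite size_image card_forest.
  - by move=> S /imageP[f fF ->]; case: (TP f fF).
(* Generation by quadratics excludes rank 0, which gives the positive rank required by
   [quadratic_fibre]. *)
have B0 := quadratics_loopless matroid quads.
have [r r_gt0 cardB] := loopless_rank matroid B0.
have quad_fibre := quadratic_fibre r_gt0 cardB.
split; first exact: quadratic_generating_seq quad_min R R_uniq R_ex quad_fibre quads.
exists [seq edges R f | f in forests (@pair_label n Bs) R]; split; [|split].
- rewrite map_inj_in_uniq ?enum_uniq // => f g; rewrite !mem_enum => fF gF e.
  by apply: (edges_sub_inj fF gF); rewrite e.
- by rewrite size_image card_forest.
- move=> S; split=> [/(minimal_quadratic quad_min R_uniq R_ex quad_fibre quads)[f fF ->]|].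
    exact: image_f.
  case/imageP=> f fF ->.
  by apply/(minimal_quadratic quad_min R_uniq R_ex quad_fibre quads); exists f.
Qed.
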